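(* Let $A$ be a matrix over a field $\mathbb{F}$ with at least one column. Then the smallest primal tree-depth of a matrix equivalent to $A$ equals the deletion-depth of the column matroid of $A$, i.e., $\mathrm{td}_P^*(A)=\mathrm{dd}(M(A))$.
   Context: Two matrices are equivalent if one can be obtained from the other by a finite sequence of row operations: adding a multiple of one row to another row, and multiplying a row by a nonzero scalar. For a graph $G$, the tree-depth $\mathrm{td}(G)$ is the minimum height of a rooted forest $F$ on the vertex set $V(G)$ such that every edge of $G$ joins a vertex to one of its ancestors in $F$; the height of a rooted forest is the maximum number of vertices on a path from a root to a leaf. The primal graph of a matrix $A$ has the columns of $A$ as vertices, two columns being adjacent if some row of $A$ has non-zero entries in both of them; $\mathrm{td}_P(A)$ is the tree-depth of the primal graph, and $\mathrm{td}_P^*(A)$ is the minimum of $\mathrm{td}_P(A')$ over all matrices $A'$ equivalent to $A$. The column matroid $M(A)$ has the columns of $A$ as elements, a set of columns being independent iff it is linearly independent. A circuit of a matroid is a minimal dependent set; a matroid is connected if every two distinct elements lie in a common circuit; components are the maximal connected restrictions (a single element matroid is connected). For an element $e$, $M\setminus e$ is the restriction of $M$ to the remaining elements. The deletion-depth $\mathrm{dd}(M)$ is defined recursively: if $M$ has a single element then $\mathrm{dd}(M)=1$; if $M$ is not connected then $\mathrm{dd}(M)$ is the maximum deletion-depth of a component of $M$; otherwise $\mathrm{dd}(M)=1+\min_e \mathrm{dd}(M\setminus e)$ over all elements $e$ of $M$. *)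

(* Defs.v *)
From mathcomp Require Import all_boot all_order all_algebra.
From mathcomp Require Import boolp.
From Stdlib Require Import Relation_Operators.
Set Implicit Arguments. Unset Strict Implicit. Unset Printing Implicit Defensive.
Import GRing.Theory.
Local Open Scope ring_scope.

Section RowOperations.
Variables (F : fieldType) (m n : nat).

Inductive row_op (A : 'M[F]_(m, n)) : 'M[F]_(m, n) -> Prop :=
| row_op_add (i j : 'I_m) (c : F) : i != j ->
    row_op A (\matrix_k (if k == i then row i A + c *: row j A else row k A))
| row_op_scale (i : 'I_m) (c : F) : c != 0 ->
    row_op A (\matrix_k (if k == i then c *: row i A else row k A)).

Definition row_equiv : 'M[F]_(m, n) -> 'M[F]_(m, n) -> Prop :=
  clos_refl_trans _ row_op.

End RowOperations.

(* The value 0 is only taken when [A] is empty. *)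
Definition min_over (T : finType) (A : {set T}) (f : T -> nat) : nat :=
  if [pick x in A] is Some x0 then f [arg min_(x < x0 in A) f x] else 0%N.

Lemma min_overP (T : finType) (A : {set T}) (f : T -> nat) : A != set0 ->
  exists2 x, x \in A &
    min_over A f = f x /\ forall y, y \in A -> (f x <= f y)%N.
Proof.
move=> /set0Pn[z zA]; rewrite /min_over; case: pickP => [x0 x0A|/(_ z)].
  by case: arg_minnP => // x xA le_x; exists x.
by rewrite /= zA.
Qed.

Section TreeDepth.
Variable V : finType.

(* A rooted forest on [V] is given by its parent function, the roots being
   the vertices without a parent. *)
Definition parent (p : {ffun V -> option V}) : rel V := fun x y => p x == Some y.

(* Every vertex counts as an ancestor of itself here. *)
Definition ancestor (p : {ffun V -> option V}) (y x : V) : bool :=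
  connect (parent p) x y.

Definition rooted_forest (p : {ffun V -> option V}) : bool :=
  [forall x, forall y, parent p x y ==> ~~ ancestor p x y].

Definition leaf (p : {ffun V -> option V}) (x : V) : bool :=
  [forall y, ~~ parent p y x].

(* The path from the root to [x] consists of the ancestors of [x]. *)
Definition height (p : {ffun V -> option V}) : nat :=
  (\max_(x | leaf p x) #|[set y | ancestor p y x]|)%N.

Definition elimination_forest (e : rel V) (p : {ffun V -> option V}) : bool :=
  rooted_forest p &&
  [forall x, forall y, e x y ==> (ancestor p x y || ancestor p y x)].

Definition treedepth (e : rel V) : nat :=
  min_over [set p | elimination_forest e p] height.

End TreeDepth.

Section PrimalTreeDepth.
Variables (F : fieldType) (m n : nat).

Definition primal_graph (A : 'M[F]_(m, n)) : rel 'I_n :=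
  fun i j => (i != j) && [exists r, (A r i != 0) && (A r j != 0)].

Definition tdP (A : 'M[F]_(m, n)) : nat := treedepth (primal_graph A).

Lemma tdP_attained (A : 'M[F]_(m, n)) :
  exists k, `[< exists2 A', row_equiv A A' & tdP A' = k >].
Proof. by exists (tdP A); apply/asboolP; exists A => //; apply: rt_refl. Qed.

Definition tdP_star (A : 'M[F]_(m, n)) : nat := ex_minn (tdP_attained A).

End PrimalTreeDepth.

(* The elements of a matroid are those of the subset [ground] of [E]. *)
Record matroid (E : finType) := Matroid {
  ground : {set E};
  indep : pred {set E};
  indep_ground : forall X, indep X -> X \subset ground;
  indep0 : indep set0;
  indep_sub : forall X Y : {set E}, X \subset Y -> indep Y -> indep X;
  indep_aug : forall X Y : {set E}, indep X -> indep Y -> (#|X| < #|Y|)%N ->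
    exists2 y, y \in Y :\: X & indep (y |: X) }.

Section Matroid.
Variable E : finType.
Implicit Types (M : matroid E) (X C : {set E}).

Definition restrict_indep M X : pred {set E} :=
  fun I => indep M I && (I \subset X).

Fact restrict_indep_ground M X I :
  restrict_indep M X I -> I \subset ground M :&: X.
Proof. by case/andP=> /indep_ground IM IX; rewrite subsetI IM. Qed.

Fact restrict_indep0 M X : restrict_indep M X set0.
Proof. by rewrite /restrict_indep indep0 sub0set. Qed.

Fact restrict_indep_sub M X (I J : {set E}) :
  I \subset J -> restrict_indep M X J -> restrict_indep M X I.
Proof.
move=> IJ /andP[iJ JX].
by rewrite /restrict_indep (indep_sub IJ iJ) (subset_trans IJ JX).
Qed.

Fact restrict_indep_aug M X (I J : {set E}) :
  restrict_indep M X I -> restrict_indep M X J -> (#|I| < #|J|)%N ->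
  exists2 y, y \in J :\: I & restrict_indep M X (y |: I).
Proof.
move=> /andP[iI IX] /andP[iJ JX] /(indep_aug iI iJ)[y yJ iy].
exists y => //; rewrite /restrict_indep iy subUset IX sub1set andbT.
by apply: (subsetP JX); case/setDP: yJ.
Qed.

Definition restrict M X : matroid E :=
  Matroid (@restrict_indep_ground M X) (restrict_indep0 M X)
    (@restrict_indep_sub M X) (@restrict_indep_aug M X).

Definition delete M (e : E) : matroid E := restrict M (ground M :\ e).

Definition circuit M C : bool :=
  minset (fun X : {set E} => (X \subset ground M) && ~~ indep M X) C.

Definition connected M : bool :=
  [forall x in ground M, forall y in ground M, (x != y) ==>
    [exists C : {set E}, [&& circuit M C, x \in C & y \in C]]].

Definition component M X : bool :=
  maxset (fun Y : {set E} => (Y \subset ground M) && connected (restrict M Y)) X.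

(* The fuel [k] is sufficient as soon as [#|ground M| <= k] (see [dd1],
   [dd_disconnected] and [dd_connected]); the value 1 for [k = 0] is used only
   if [ground M] is empty, a case the recursion does not define. *)
Fixpoint dd_rec (k : nat) M : nat :=
  if k is k'.+1 then
    if #|ground M| == 1%N then 1%N
    else if ~~ connected M then
      (\max_(X : {set E} | component M X) dd_rec k' (restrict M X))%N
    else (min_over (ground M) (fun e => dd_rec k' (delete M e))).+1
  else 1%N.

Definition dd M : nat := dd_rec #|ground M| M.

Lemma component_proper M X :
  ~~ connected M -> component M X -> (#|ground (restrict M X)| < #|ground M|)%N.
Proof.
move=> ncM /maxsetp/andP[XM cX]; rewrite /= (setIidPr XM).
rewrite proper_card // properEneq XM andbT.
apply: contraNneq ncM => eX; move: cX.
rewrite /connected /= eX setIid => /'forall_in_forall_inP cM.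
apply/'forall_in_forall_inP => x xM y yM; apply/implyP => xy.
have /implyP/(_ xy)/existsP[C /and3P[cC xC yC]] := cM x xM y yM.
apply/existsP; exists C; rewrite xC yC !andbT.
rewrite /circuit -(minset_eq (P1 := fun Z : {set E} =>
  (Z \subset ground (restrict M (ground M))) &&
  ~~ indep (restrict M (ground M)) Z)) //= => Z.
rewrite /= /restrict_indep setIid.
by case: (Z \subset _); rewrite ?andbT.
Qed.

Lemma delete_proper M e :
  e \in ground M -> (#|ground (delete M e)| < #|ground M|)%N.
Proof.
by move=> eM; rewrite /= (setIidPr (subsetDl _ _)) [ltnRHS](cardsD1 e) eM.
Qed.

Lemma eq_min_over (T : finType) (A : {set T}) (f g : T -> nat) :
  {in A, f =1 g} -> min_over A f = min_over A g.
Proof.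
move=> fg; have [->|A0] := eqVneq A set0.
  by rewrite /min_over; case: pickP => // x; rewrite inE.
have [x xA [-> fx]] := min_overP f A0; have [y yA [-> gy]] := min_overP g A0.
by apply/eqP; rewrite eqn_leq -{1}(fg _ yA) fx //= (fg _ xA) gy.
Qed.

Lemma dd_rec_fuel j k M : (#|ground M| <= j)%N -> (#|ground M| <= k)%N ->
  dd_rec j M = dd_rec k M.
Proof.
wlog jk : j k / (j <= k)%N => [wl Mj Mk|].
  by case/orP: (leq_total j k) => /wl ->.
elim: j k M jk => [|j IH] [|k] M //= jk Mj Mk.
  have M0 : ground M = set0 by apply/eqP; rewrite -cards_eq0 -leqn0.
  have cM : connected M by apply/forall_inP => x; rewrite M0 in_set0.
  by rewrite M0 cards0 cM /= /min_over; case: pickP => // x; rewrite /= in_set0.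
case: eqP => // _; case: ifP => [ncM|_].
  apply: eq_bigr => X cX; have lt := component_proper ncM cX.
  by apply: IH => //; rewrite -ltnS; apply: leq_trans lt _.
congr _.+1; apply: eq_min_over => e eM; have lt := delete_proper eM.
by apply: IH => //; rewrite -ltnS; apply: leq_trans lt _.
Qed.

Lemma dd1 M : #|ground M| = 1%N -> dd M = 1%N.
Proof. by rewrite /dd => M1; rewrite M1 /= M1. Qed.

Lemma dd_disconnected M : ~~ connected M ->
  dd M = (\max_(X : {set E} | component M X) dd (restrict M X))%N.
Proof.
move=> ncM; rewrite /dd; case eqM: #|ground M| => [|k] /=.
  case/negP: ncM; apply/forall_inP => x.
  by move/eqP: eqM; rewrite cards_eq0 => /eqP->; rewrite in_set0.
rewrite ifF; last first.
  apply/negP => /cards1P[x Mx]; case/negP: ncM.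
  apply/'forall_in_forall_inP => y; rewrite Mx => /set1P-> z /set1P->.
  by rewrite eqxx.
rewrite ncM; apply: eq_bigr => X /(component_proper ncM).
by rewrite eqM ltnS => lt; apply: dd_rec_fuel.
Qed.

Lemma dd_connected M : connected M -> (1 < #|ground M|)%N ->
  dd M = (min_over (ground M) (fun e => dd (delete M e))).+1.
Proof.
rewrite /dd => cM; case eqM: #|ground M| => [|k] // k0.
rewrite /= eqM (gtn_eqF k0) cM /=; congr _.+1; apply: eq_min_over => e.
by move/delete_proper; rewrite eqM ltnS => lt; apply: dd_rec_fuel.
Qed.

End Matroid.

Section ColumnMatroid.
Variables (F : fieldType) (m n : nat) (A : 'M[F]_(m, n)).

(* Freeness of the family, so that equal columns are dependent. *)
Definition col_indep : pred {set 'I_n} :=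
  fun X => free [seq col j A | j <- enum X].

Fact col_indep_ground X : col_indep X -> X \subset [set: 'I_n].
Proof. by move=> _; apply: subsetT. Qed.

Fact col_indep0 : col_indep set0.
Proof. by rewrite /col_indep enum_set0 nil_free. Qed.

Fact perm_enumU1 y (X : {set 'I_n}) :
  y \notin X -> perm_eq (enum (y |: X)) (y :: enum X).
Proof.
move=> yX; apply: uniq_perm; rewrite /= ?enum_uniq ?mem_enum ?yX //.
by move=> z; rewrite inE !mem_enum !inE.
Qed.

Fact col_indep_sub (X Y : {set 'I_n}) :
  X \subset Y -> col_indep Y -> col_indep X.
Proof.
move=> XY; rewrite /col_indep.
have /(perm_map (fun j : 'I_n => col j A))/perm_free-> : perm_eq (enum Y) (enum X ++ enum (Y :\: X)).
  apply: uniq_perm; rewrite ?enum_uniq // ?cat_uniq ?enum_uniq ?andbT /=.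
    apply/hasPn => z; rewrite !mem_enum inE.
    by case/andP.
  move=> z; rewrite mem_cat !mem_enum inE.
  by case: (boolP (z \in X)) => // /(subsetP XY).
by rewrite map_cat => /catl_free.
Qed.

Fact col_indep_aug (X Y : {set 'I_n}) :
  col_indep X -> col_indep Y -> (#|X| < #|Y|)%N ->
  exists2 y, y \in Y :\: X & col_indep (y |: X).
Proof.
move=> iX iY XY; apply/exists_inP; apply: contraLR XY => /exists_inPn noY.
rewrite -leqNgt; move: (iX) (iY); rewrite /col_indep /free !size_map -!cardE.
move=> /eqP<- /eqP<-; apply/dimvS/span_subvP => _ /mapP[y yY ->].
rewrite mem_enum in yY; have [yX|yX] := boolP (y \in X).
  by apply/memv_span/map_f; rewrite mem_enum.
have := noY y; rewrite !inE yX yY => /(_ isT); apply: contraNT => ynS.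
rewrite /col_indep (perm_free (perm_map (fun j : 'I_n => col j A) (perm_enumU1 yX))) /=.
by rewrite free_cons ynS.
Qed.

Definition column_matroid : matroid 'I_n :=
  Matroid col_indep_ground col_indep0 col_indep_sub col_indep_aug.

End ColumnMatroid.

(* Main.v *)
Require Import Defs.
From mathcomp Require Import all_boot all_order all_algebra.
From mathcomp Require Import boolp.
From Stdlib Require Import Relation_Operators.
Set Implicit Arguments. Unset Strict Implicit. Unset Printing Implicit Defensive.
Import GRing.Theory.

(* Both parameters are values of one recursion [depth_le] on sets of columns:
   the empty set has depth 0, deleting an element costs 1, and splitting a set
   into two separated parts is free. For tree-depth, separated means that no
   edge joins the two parts; for deletion-depth, that every circuit lies in
   one of them, equivalently that the row space of [A] on these columns is the
   direct sum of its projections to the two parts. Two parts with no edge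
   between them in the primal graph of a matrix equivalent to [A] are separated
   in the matroid, which bounds the deletion-depth by the tree-depth.
   Conversely, a derivation for the matroid is turned into a spanning set of
   the row space with a derivation for its primal graph: at a separation the
   spanning sets of the two summands are put together; at the deletion of [x]
   the spanning vectors of the projection are lifted, and the multiples of the
   unit vector of [x] in the row space are added, which creates no edge
   outside [x]. Finally a basis is extracted and padded with zero rows, and
   matrices of equal shape and row space are related by row operations. *)

(** * The recursion common to both parameters *)

Section Depth.
Variable T : finType.
Implicit Types (sep : {set T} -> {set T} -> Prop) (X Y : {set T}) (k : nat).

(** The index is an upper bound: the empty set gets every [k], and the two parts of a separation
    share one [k], which therefore bounds their maximum. *)
Inductive depth_le sep : nat -> {set T} -> Prop :=
| depth_le0 k : depth_le sep k set0
| depth_le_sep k X Y : Y \subset X -> sep X Y ->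
    depth_le sep k Y -> depth_le sep k (X :\: Y) -> depth_le sep k X
| depth_le_del k X x : x \in X ->
    depth_le sep k (X :\ x) -> depth_le sep k.+1 X.

Lemma depth_leW sep j k X : j <= k -> depth_le sep j X -> depth_le sep k X.
Proof.
move=> jk dX; elim: dX k jk => {j X} [j k _|j X Y YX sXY _ IHY _ IHZ k jk|].
- exact: depth_le0.
- by apply: depth_le_sep (IHY _ jk) (IHZ _ jk).
by move=> j X x xX _ IH [|k] // /IH; apply: depth_le_del.
Qed.

(** A derivation for [X] only visits subsets of [X], so the separations are compared only there;
    this allows a stacked matrix to be compared with one of its blocks. *)
Lemma sub_depth_le sep sep' k X :
    (forall Y Z : {set T}, Y \subset X -> Z \subset Y -> sep Y Z -> sep' Y Z) ->
  depth_le sep k X -> depth_le sep' k X.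
Proof.
move=> sepW dX; elim: dX sepW => {k X}; first by move=> k _; apply: depth_le0.
- move=> k X Y YX sXY _ IHY _ IHZ sepW; apply: (depth_le_sep (Y := Y)) => //.
  + exact: sepW.
  + by apply: IHY => Z Z' ZY; apply: sepW; apply: subset_trans YX.
  by apply: IHZ => Z Z' ZY; apply: sepW; apply: (subset_trans ZY (subsetDl _ _)).
move=> k X x xX _ IH sepW; apply: (depth_le_del xX); apply: IH => Z Z' ZX.
by apply: sepW; apply: (subset_trans ZX (subsetDl _ _)).
Qed.

Lemma depth_le_card sep X : depth_le sep #|X| X.
Proof.
move eqn: #|X| => n; elim: n X eqn => [|n IH] X Xn.
  by rewrite (cards0_eq Xn); apply: depth_le0.
have /set0Pn[x xX] : X != set0 by rewrite -card_gt0 Xn.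
apply: (depth_le_del xX); apply: IH.
by apply/eqP; rewrite -eqSS -Xn (cardsD1 x X) xX.
Qed.

End Depth.

(** * Rooted forests as orders, and tree-depth as a derivation *)

Section ForestOrder.
Variable V : finType.
Implicit Types (e r : rel V) (X Y : {set V}) (p : {ffun V -> option V}).

Definition edge_sep e X Y : Prop :=
  forall y z, y \in Y -> z \in X :\: Y -> ~~ e y z.

(* [r x y] reads: [y] is an ancestor of [x]. *)
Definition forest_order X r : Prop :=
  [/\ forall x y, r x y -> (x \in X) && (y \in X),
      {in X, reflexive r}, antisymmetric r, transitive r
    & forall x y z, r x y -> r x z -> r y z || r z y].

(** Parents are unique, so both ancestors lie on the one parent path that starts at [x]. *)
Lemma ancestor_comparable p x y z :
  ancestor p y x -> ancestor p z x -> ancestor p z y || ancestor p y z.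
Proof.
rewrite /ancestor => /connectP[s]; elim: s x => [|a s IH] x /=.
  by move=> _ -> ->.
case/andP=> xa sa ey /[dup] xz /connectP[[|b t]] /=.
  move=> _ ->; apply/orP; right; apply/connectP; exists (a :: s) => //=.
  by rewrite xa.
case/andP=> xb tb ez.
have ab : a = b by move: xa xb; rewrite /parent => /eqP-> /eqP[].
by apply: (IH a) => //; apply/connectP; exists t; rewrite ?ab.
Qed.

Lemma ancestor_anti p : rooted_forest p -> antisymmetric (connect (parent p)).
Proof.
move=> /forallP rf x y /andP[/connectP[[|a s]] /=]; first by move=> _ ->.
case/andP=> xa sa ey yx.
have /forallP/(_ a)/implyP/(_ xa)/negP[] := rf x.
by apply: connect_trans yx; apply/connectP; exists s.
Qed.

Lemma forest_order_ancestor p :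
  rooted_forest p -> forest_order setT (connect (parent p)).
Proof.
move=> rf; split=> [x y|x _||x y z|x y z xy xz]; rewrite ?inE //.
- exact: ancestor_anti.
- exact: connect_trans.
by rewrite orbC; apply: (ancestor_comparable (x := x)).
Qed.

(** [height] looks at leaves only, but a descendant [z] of [x] with the fewest descendants is a
    leaf, and every ancestor of [x] is an ancestor of [z]. *)
Lemma card_ancestor_height p x : rooted_forest p ->
  #|[set y | ancestor p y x]| <= height p.
Proof.
move=> rf; have [z] := @arg_minnP _ x (connect (parent p) ^~ x)
  (fun z => #|[set y | connect (parent p) y z]|) (connect0 _ _).
move=> zx zmin.
have lz : leaf p z.
  apply/forallP => y; apply/negP => yz.
  have := zmin y (connect_trans (connect1 yz) zx); rewrite leqNgt => /negP[].
  apply/proper_card/properP; split.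
    apply/subsetP => t; rewrite !inE => ty.
    exact: connect_trans ty (connect1 yz).
  exists z; rewrite !inE ?connect0 //; apply/negP => zy.
  by move/forallP: rf => /(_ y)/forallP/(_ z)/implyP/(_ yz)/negP[].
rewrite /height (bigD1 z) //= leq_max; apply/orP; left.
apply/subset_leq_card/subsetP => t; rewrite !inE => xt.
exact: connect_trans zx xt.
Qed.

(** Induction on the size of a set [X] closed under descendants. If [X] is a single tree, its root
    is deleted, which shortens every chain by one; otherwise one tree is separated from the rest,
    and no edge leaves it, since edges join comparable vertices. *)
Lemma forest_order_depth_le e r k X :
    forest_order setT r -> (forall x y, e x y -> r x y || r y x) ->
    (forall x y, r x y -> y \in X -> x \in X) ->
    (forall x, x \in X -> #|[set y in X | r x y]| <= k) ->
  depth_le (edge_sep e) k X.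
Proof.
case=> _ rxx ranti rtrans rchain er.
have refl x : r x x by apply: rxx; rewrite inE.
move eqn: #|X| => n; elim/ltn_ind: n k X eqn => n IH k X eqn Xdown Xk.
have [->|/set0Pn[x0 x0X]] := eqVneq X set0; first exact: depth_le0.
(* An element with the fewest ancestors in [X] is a root of [X]. *)
have [x xX xmin] := @arg_minnP _ x0 (mem X)
  (fun z => #|[set y in X | r z y]|) x0X.
have xtop y : y \in X -> r x y -> y = x.
  move=> yX xy; apply/eqP; apply: contraTT isT => yx.
  have := xmin y yX; rewrite leqNgt => /negP[].
  apply/proper_card/properP; split.
    apply/subsetP => t; rewrite !inE => /andP[-> yt].
    exact: rtrans xy yt.
  exists x; rewrite !inE ?[x \in X]xX ?refl //=; apply: contra yx => yx.
  by apply/eqP/ranti; rewrite yx xy.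
pose Y := [set y in X | r y x].
have YX : Y \subset X by apply/subsetP => y; rewrite inE => /andP[].
have Zdown y z : r y z -> z \in X :\: Y -> y \in X :\: Y.
  move=> yz /setDP[zX zY]; rewrite inE (Xdown y z) // andbT.
  apply: contra zY; rewrite !inE zX => /andP[_ yx].
  case/orP: (rchain _ _ _ yx yz) => // xz.
  by rewrite (xtop z zX xz) refl.
have [eqY|neqY] := eqVneq Y X.
  (* The case [k = 0] is void, as [x] is its own ancestor. *)
  case: k Xk => [/(_ x xX)|k Xk].
    by rewrite leqn0 cards_eq0 => /eqP/setP/(_ x); rewrite !inE refl [x \in X]xX.
  have lt : #|X :\ x| < n.
    by rewrite -eqn (cardsD1 x X) [x \in X]xX.
  apply: (depth_le_del (x := x)) => //; apply: (IH _ lt) => //.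
    move=> y z yz /setD1P[zx zX]; apply/setD1P; split; last exact: Xdown zX.
    by apply: contraNneq zx => yx; rewrite (xtop z zX) // -yx.
  move=> y /setD1P[yx yX]; rewrite -ltnS; apply: leq_trans (Xk y yX).
  apply/proper_card/properP; split.
    by apply/subsetP => t; rewrite !inE => /andP[/andP[_ ->] ->].
  exists x; rewrite !inE ?eqxx // [x \in X]xX.
  by move: yX; rewrite -{1}eqY inE => /andP[].
have ltY : #|Y| < n by rewrite -eqn proper_card // properEneq neqY.
have ltZ : #|X :\: Y| < n.
  rewrite -eqn proper_card //; apply/properP; split; first exact: subsetDl.
  by exists x; rewrite // !inE [x \in X]xX refl.
apply: (depth_le_sep YX).
- move=> y z yY zZ; apply: contraTN zZ => /er/orP[] yz.
    move: yY; apply: contraTN => zZ; have /setDP[_] := Zdown _ _ yz zZ.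
    by [].
  move: (yY); rewrite !inE => /andP[yX yx].
  by rewrite (rtrans _ _ _ yz yx) (Xdown _ _ yz yX).
- apply: (IH _ ltY) => // [y z yz|y yY].
    by rewrite !inE => /andP[zX zx]; rewrite (Xdown _ _ yz) // (rtrans _ _ _ yz).
  apply: leq_trans (Xk y (subsetP YX y yY)); apply: subset_leq_card.
  by apply/subsetP => t; rewrite !inE => /andP[/andP[-> _] ->].
apply: (IH _ ltZ) => // y /setDP[yX _]; apply: leq_trans (Xk y yX).
apply: subset_leq_card.
by apply/subsetP => t; rewrite !inE => /andP[/andP[_ ->] ->].
Qed.

(** The forest is built along the derivation: a separation puts two forests side by side, and a
    deletion adds [x] as a new root above everything. *)
Lemma depth_le_forest_order e k X : symmetric e ->
    depth_le (edge_sep e) k X ->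
  exists r, [/\ forest_order X r, forall x, #|[set y | r x y]| <= k
    & {in X &, forall x y, e x y -> r x y || r y x}].
Proof.
move=> esym dX; elim: dX => {k X} [k|k X Y YX sXY _ [r [Fr rk re]] _ [s [Fs sk se]]|].
- exists (fun _ _ => false); split=> [|x|x y]; last by rewrite inE.
    by split=> // x; rewrite inE.
  by rewrite (_ : [set _ | _] = set0) ?cards0 //; apply/setP => y; rewrite !inE.
- have [rX rr ra rt rc] := Fr; have [sX sr sa st sc] := Fs.
  (* The two orders live on disjoint sets, so no chain mixes them. *)
  have rs x y z t : r x y -> s z t -> [&& x != z, x != t, y != z & y != t].
    move=> /rX/andP[xY yY] /sX; rewrite !inE => /andP[/andP[zY _] /andP[tY _]].
    by apply/and4P; split; [move: zY|move: tY|move: zY|move: tY];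
       apply: contraNneq => <-.
  exists (fun x y => r x y || s x y); split.
  + split.
    * move=> x y /orP[/rX/andP[xY yY]|/sX]; first by rewrite !(subsetP YX).
      by rewrite !inE => /andP[/andP[_ ->] /andP[_ ->]].
    * move=> x xX; have [/rr->//|xY] := boolP (x \in Y).
      by rewrite sr ?orbT // !inE xY.
    * move=> x y /andP[/orP[] xy /orP[] yx].
      - by apply: ra; rewrite xy.
      - by have := rs _ _ _ _ xy yx; rewrite eqxx andbF.
      - by have := rs _ _ _ _ yx xy; rewrite eqxx andbF.
      by apply: sa; rewrite xy.
    * move=> y x z /orP[] xy /orP[] yz.
      - by rewrite (rt _ _ _ xy yz).
      - by have := rs _ _ _ _ xy yz; rewrite eqxx !andbF.
      - by have := rs _ _ _ _ yz xy; rewrite eqxx !andbF.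
      by rewrite (st _ _ _ xy yz) orbT.
    move=> x y z /orP[] xy /orP[] xz.
    * by case/orP: (rc _ _ _ xy xz) => ->; rewrite ?orbT.
    * by have := rs _ _ _ _ xy xz; rewrite eqxx.
    * by have := rs _ _ _ _ xz xy; rewrite eqxx.
    by case/orP: (sc _ _ _ xy xz) => ->; rewrite ?orbT.
  + move=> x; have [xY|xY] := boolP (x \in Y).
      apply: leq_trans (rk x); apply/subset_leq_card/subsetP => y.
      by rewrite !inE => /orP[//|/sX]; rewrite !inE xY.
    apply: leq_trans (sk x); apply/subset_leq_card/subsetP => y.
    by rewrite !inE => /orP[/rX|//]; rewrite (negPf xY).
  move=> x y xX yX exy.
  have [xY|xY] := boolP (x \in Y); have [yY|yY] := boolP (y \in Y).
  + by case/orP: (re x y xY yY exy) => ->; rewrite ?orbT.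
  + by have := sXY x y xY; rewrite exy inE yY yX => /(_ isT).
  + by have := sXY y x yY; rewrite esym exy inE xY xX => /(_ isT).
  have := se x y; rewrite !inE xY yY => /(_ xX yX exy).
  by case/orP=> ->; rewrite ?orbT.
move=> k X x xX _ [r [[rX rr ra rt rc] rk re]].
have rx y z : r y z -> (y != x) && (z != x).
  by move=> /rX; rewrite !inE => /andP[/andP[-> _] /andP[-> _]].
(* Every element of [X], including [x], gets [x] as an ancestor, so each chain grows by at most
   one. *)
exists (fun y z => r y z || (y \in X) && (z == x)); split.
- split.
  + move=> y z /orP[/rX|/andP[-> /eqP->//]].
    by rewrite !inE => /andP[/andP[_ ->] /andP[_ ->]].
  + move=> y yX; rewrite yX; have [//|yx] := eqVneq y x; first by rewrite orbT.
    by rewrite rr // !inE yx.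
  + move=> y z /andP[/orP[yz|/andP[yX /eqP zx]] /orP[zy|/andP[zX /eqP yx]]].
    * by apply: ra; rewrite yz.
    * by have := rx _ _ yz; rewrite yx eqxx.
    * by have := rx _ _ zy; rewrite zx eqxx.
    by rewrite yx.
  + move=> z y t /orP[yz|/andP[yX /eqP zx]] /orP[zt|/andP[zX /eqP tx]].
    * by rewrite (rt _ _ _ yz zt).
    * have := rX _ _ yz; rewrite !inE tx eqxx => /andP[/andP[_ ->]].
      by rewrite orbT.
    * by have := rx _ _ zt; rewrite zx eqxx.
    by rewrite yX tx eqxx orbT.
  move=> y z t /orP[yz|/andP[yX /eqP->]] /orP[yt|/andP[yX' /eqP->]].
  + by case/orP: (rc _ _ _ yz yt) => ->; rewrite ?orbT.
  + have := rX _ _ yz; rewrite !inE eqxx => /andP[_ /andP[_ ->]].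
    by rewrite orbT.
  + have := rX _ _ yt; rewrite !inE eqxx => /andP[_ /andP[_ ->]].
    by rewrite !orbT.
  by rewrite xX eqxx orbT.
- move=> y; apply: leq_trans (_ : #|x |: [set z | r y z]| <= _).
    apply/subset_leq_card/subsetP => z; rewrite !inE.
    by case/orP=> [->|/andP[_ ->//]]; rewrite orbT.
  by apply: leq_trans (leq_card_setU _ _) _; rewrite cards1 add1n ltnS.
move=> y z yX zX eyz; rewrite yX zX /=.
have [//|yx] := eqVneq y x; first by rewrite !orbT.
have [//|zx] := eqVneq z x; first by rewrite !orbT.
by rewrite !orbF re // !inE ?yx ?zx.
Qed.

(** The parent of [x] is its closest strict ancestor; following parents reaches every ancestor, by
    induction on the number of ancestors, which drops at each step. *)
Lemma forest_order_parent r : forest_order setT r ->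
  exists2 p, rooted_forest p & connect (parent p) =2 r.
Proof.
case=> _ rxx ra rt rc; have refl x : r x x by apply: rxx; rewrite inE.
pose closest x y := [&& y != x, r x y & [forall z, (z != x) && r x z ==> r y z]].
pose p : {ffun V -> option V} := [ffun x => [pick y | closest x y]].
have par x y : parent p x y -> closest x y.
  by rewrite /parent ffunE; case: pickP => // z xz /eqP[<-].
have conn x y : connect (parent p) x y -> r x y.
  case/connectP=> s; elim: s x => [|a s IH] x /=; first by move=> _ ->.
  case/andP=> /par/and3P[_ xa _] sa ey; apply: rt xa _; exact: IH.
exists p.
  apply/forallP => x; apply/forallP => y; apply/implyP => /par/and3P[yx xy _].
  apply/negP => /conn yx'; case/eqP: yx; apply: ra.
  by rewrite yx' xy.
move=> x y; apply/idP/idP => [/conn//|].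
move eqn: #|[set z | r x z]| => n.
elim/ltn_ind: n x eqn => n IH x eqn xy.
have [->|yx] := eqVneq y x; first exact: connect0.
have y0P : (y != x) && r x y by rewrite yx.
(* The strict ancestors of [x] form a chain, so one with the most ancestors of its own is the
   closest. *)
have [z /andP[zx xz] zmax] := @arg_maxnP _ y (fun z => (z != x) && r x z)
   (fun z => #|[set t | r z t]|) y0P.
have clz : closest x z.
  rewrite /closest zx xz; apply/forallP => t; apply/implyP => tP.
  case/andP: (tP) => _ xt; case/orP: (rc _ _ _ xz xt) => // tz.
  have eqzt : [set u | r z u] == [set u | r t u].
    rewrite eqEcard; apply/andP; split; last exact: zmax.
    by apply/subsetP => u; rewrite !inE => /(rt _ _ _ tz).
  by move/eqP/setP/(_ t): eqzt; rewrite !inE refl.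
have [w xw] : exists w, parent p x w.
  by rewrite /parent ffunE; case: pickP => [w _|/(_ z)]; [exists w|rewrite clz].
have /and3P[wx rxw /forallP/(_ y)/implyP/(_ y0P) wy] := par _ _ xw.
apply: connect_trans (connect1 xw) _; apply: IH wy; last by [].
rewrite -eqn proper_card //; apply/properP; split.
  by apply/subsetP => u; rewrite !inE => /(rt _ _ _ rxw).
exists x; rewrite !inE ?refl //; apply: contra wx => wx.
by apply/eqP/ra; rewrite wx rxw.
Qed.

Lemma treedepth_le e k : symmetric e ->
  treedepth e <= k <-> depth_le (edge_sep e) k setT.
Proof.
move=> esym.
have build j : depth_le (edge_sep e) j setT ->
    exists2 p, elimination_forest e p & height p <= j.
  case/(depth_le_forest_order esym) => r [Fr rj re].
  have [p fp pr] := forest_order_parent Fr; exists p.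
    rewrite /elimination_forest fp; apply/forallP => x; apply/forallP => y.
    by rewrite /ancestor !pr orbC; apply/implyP/re; rewrite inE.
  apply/bigmax_leqP => x _; apply: leq_trans (rj x).
  by apply/subset_leq_card/subsetP => y; rewrite !inE /ancestor pr.
(* Deleting the vertices one by one gives some elimination forest, so the minimum in [treedepth] is
   taken over a nonempty set and does not default to 0. *)
have [p0 p0e _] := build _ (depth_le_card _ _).
have /min_overP-/(_ (@height V)) : [set p | elimination_forest e p] != set0.
  by apply/set0Pn; exists p0; rewrite inE.
rewrite -/(treedepth e) => -[p]; rewrite inE => pe [-> pmin]; split.
  case/andP: pe => fp /forallP pe le_k; apply: depth_leW le_k _.
  apply: (forest_order_depth_le (forest_order_ancestor fp)) => //.
    by move=> x y /(implyP (forallP (pe x) y)); rewrite orbC.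
  move=> x _; apply: leq_trans (card_ancestor_height x fp).
  by apply/subset_leq_card/subsetP => y; rewrite !inE.
by case/build=> q qe; apply: leq_trans; apply: pmin; rewrite inE.
Qed.

End ForestOrder.

(** * Row equivalence as equality of row spaces *)

Section RowEquiv.
Local Open Scope ring_scope.
Variables (F : fieldType) (m : nat).

Lemma row_op_sym n (A B : 'M[F]_(m, n)) : row_op A B -> row_op B A.
Proof.
case=> [i j c ij|i c c0].
  set B' := (X in row_op X A).
  suff -> : A = \matrix_k (if k == i then row i B' + - c *: row j B' else row k B').
    exact: row_op_add.
  apply/matrixP => k l; rewrite !mxE; have [->|ki] := eqVneq k i.
    by rewrite !mxE eqxx eq_sym (negPf ij) !mxE mulNr addrK.
  by rewrite !mxE (negPf ki) !mxE.
set B' := (X in row_op X A).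
suff -> : A = \matrix_k (if k == i then c^-1 *: row i B' else row k B').
  by apply: row_op_scale; rewrite invr_eq0.
apply/matrixP => k l; rewrite !mxE; have [->|ki] := eqVneq k i.
  by rewrite !mxE eqxx !mxE mulKf.
by rewrite !mxE (negPf ki) !mxE.
Qed.

Lemma row_equiv_sym n (A B : 'M[F]_(m, n)) : row_equiv A B -> row_equiv B A.
Proof.
elim=> [A' B' /row_op_sym|A'|A' B' C _ BA _ CB]; first exact: rt_step.
  exact: rt_refl.
exact: rt_trans CB BA.
Qed.

Lemma row_op_mulmxr n p (A B : 'M[F]_(m, n)) (C : 'M[F]_(n, p)) :
  row_op A B -> row_op (A *m C) (B *m C).
Proof.
case=> [i j c ij|i c c0].
  set B' := (X in row_op _ X).
  suff -> : B' = \matrix_k (if k == i then row i (A *m C) + c *: row j (A *m C)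
                            else row k (A *m C)) by exact: row_op_add.
  apply/row_matrixP => k; rewrite {}/B' row_mul !rowK.
  by case: ifP => _; rewrite ?mulmxDl -?scalemxAl !row_mul.
set B' := (X in row_op _ X).
suff -> : B' = \matrix_k (if k == i then c *: row i (A *m C)
                          else row k (A *m C)) by exact: row_op_scale.
apply/row_matrixP => k; rewrite {}/B' row_mul !rowK.
by case: ifP => _; rewrite -?scalemxAl !row_mul.
Qed.

Lemma row_equiv_mulmxr n p (A B : 'M[F]_(m, n)) (C : 'M[F]_(n, p)) :
  row_equiv A B -> row_equiv (A *m C) (B *m C).
Proof.
elim=> [A' B' /(row_op_mulmxr C)|A'|A' B' D _ AB _ BD]; first exact: rt_step.
  exact: rt_refl.
exact: rt_trans AB BD.
Qed.

Lemma row_equiv_submx n (A B : 'M[F]_(m, n)) : row_equiv A B -> (B <= A)%MS.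
Proof.
elim=> [A' B' op|A'|A' B' C _ BA _ CB]; last exact: submx_trans CB BA.
  case: op => [i j c ij|i c c0]; apply/row_subP => k; rewrite rowK;
    case: ifP => _; rewrite ?row_sub //.
    by rewrite addmx_sub ?row_sub // scalemx_sub ?row_sub.
  by rewrite scalemx_sub ?row_sub.
exact: submx_refl.
Qed.

(** Rows are treated one at a time; [c k = 0] keeps row [k] unchanged throughout. *)
Lemma row_equiv_add_multiples n (A : 'M[F]_(m, n)) (k : 'I_m) (c : 'I_m -> F) :
    c k = 0 ->
  row_equiv A (\matrix_i (row i A + c i *: row k A)).
Proof.
move=> ck0; pose B (s : seq 'I_m) := \matrix_i (row i A + (if i \in s then c i else 0) *: row k A).
suff eqB s : uniq s -> row_equiv A (B s).
  have -> : \matrix_i (row i A + c i *: row k A) = B (enum 'I_m).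
    by apply/row_matrixP => i; rewrite !rowK mem_enum.
  by apply: eqB; apply: enum_uniq.
elim: s => [_|a s IH /andP[as_ us]].
  rewrite (_ : B [::] = A); first exact: rt_refl.
  by apply/row_matrixP => i; rewrite rowK scale0r addr0.
apply: rt_trans (IH us) _; have [ak|ak] := eqVneq a k.
  rewrite (_ : B (a :: s) = B s); first exact: rt_refl.
  apply/row_matrixP => i; rewrite !rowK inE.
  by have [->|//] := eqVneq i a; rewrite ak ck0 if_same.
have -> : B (a :: s) = \matrix_i (if i == a then row a (B s) + c a *: row k (B s)
                                  else row i (B s)).
  apply/row_matrixP => i; rewrite !rowK inE; have [->|//] := eqVneq i a.
  by rewrite (negPf as_) scale0r addr0 ck0 if_same scale0r addr0.
exact/rt_step/row_op_add.
Qed.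

Lemma row_equiv_eqmx n (A B : 'M[F]_(m, n)) : row_equiv A B -> (A :=: B)%MS.
Proof.
move=> AB; apply/eqmxP; rewrite (row_equiv_submx AB).
by rewrite (row_equiv_submx (row_equiv_sym AB)).
Qed.

(** One round of Gauss-Jordan elimination, with [J] the set of columns already reduced. *)
Lemma row_equiv_pivot (U : 'M[F]_m) (k : 'I_m) (J : {set 'I_m}) :
    U \in unitmx -> k \notin J -> (forall i j, j \in J -> U i j = (i == j)%:R) ->
  exists2 U', row_equiv U U' &
    (forall i j, j \in k |: J -> U' i j = (i == j)%:R).
Proof.
move=> Uu kJ UJ.
(* Otherwise column [k] would be a combination of the unit columns in [J], and [c] would be a
   nonzero kernel vector of the invertible [U]. *)
have [i iJ Uik] : exists2 i, i \notin J & U i k != 0.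
  apply/exists_inP; apply: contraT => /exists_inPn /= U0.
  pose c : 'cV_m := \col_j (if j == k then 1 else if j \in J then - U j k else 0).
  have : U *m c = 0.
    apply/colP => i; rewrite !mxE (bigD1 k) //= !mxE eqxx mulr1.
    have [iJ|iJ] := boolP (i \in J).
      have ik : i != k by apply: contraNneq kJ => <-.
      rewrite (bigD1 i) //= !mxE (negPf ik) iJ (UJ i i iJ) eqxx mul1r addrA subrr add0r.
      rewrite big1 // => j /andP[jk ji]; rewrite !mxE (negPf jk).
      case: ifP => jJ; last by rewrite mulr0.
      by rewrite UJ // eq_sym (negPf ji) mul0r.
    have /negPn/eqP-> := U0 i iJ; rewrite add0r big1 // => j jk.
    rewrite !mxE (negPf jk); case: ifP => jJ; last by rewrite mulr0.
    rewrite UJ //; case: eqP => [ij|]; last by rewrite mul0r.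
    by rewrite ij jJ in iJ.
  move/(congr1 (mulmx (invmx U))); rewrite mulKmx // mulmx0 => /colP/(_ k).
  by rewrite !mxE eqxx => /eqP; rewrite oner_eq0.
(* Row swaps are not among the operations: if the pivot entry is zero, row [i] is added to row [k].
   Row [i] vanishes on the columns in [J] because [i] is not in [J]. *)
have [V UV [VJ Vk]] : exists2 V, row_equiv U V &
    (forall i j, j \in J -> V i j = (i == j)%:R) /\ V k k != 0.
  have [Ukk|Ukk] := eqVneq (U k k) 0; last by exists U => //; apply: rt_refl.
  have ki : k != i by apply: contraNneq Uik => <-; rewrite Ukk.
  exists (\matrix_l (if l == k then row k U + 1 *: row i U else row l U)).
    exact/rt_step/row_op_add.
  split=> [l j jJ|]; rewrite !mxE; last by rewrite eqxx !mxE Ukk add0r mul1r.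
  case: eqP => [->|_]; rewrite !mxE ?UJ // mul1r.
  by case: (eqVneq i j) => [ij|_]; rewrite ?addr0 // -ij (negPf iJ) in jJ *.
(* The pivot is scaled to 1, then the rest of column [k] is cleared; row [k] vanishes on [J], so the
   columns there do not change. *)
pose W := \matrix_l (if l == k then (V k k)^-1 *: row k V else row l V).
have VW : row_equiv V W by apply/rt_step/row_op_scale; rewrite invr_eq0.
have kjF j : j \in J -> (k == j) = false.
  by move=> jJ; apply: contraNF kJ => /eqP->.
have WJ l j : j \in J -> W l j = (l == j)%:R.
  move=> jJ; rewrite !mxE; case: eqP => [->|_]; rewrite !mxE (VJ _ _ jJ) //.
  by rewrite kjF // mulr0.
have Wk : W k k = 1 by rewrite !mxE eqxx !mxE mulVf.
pose c l := if l == k then 0 else - W l k.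
exists (\matrix_l (row l W + c l *: row k W)).
  apply: rt_trans UV _; apply: rt_trans VW _.
  by apply: row_equiv_add_multiples; rewrite /c eqxx.
have E l j : (\matrix_l (row l W + c l *: row k W)) l j = W l j + c l * W k j.
  by rewrite mxE [LHS]mxE; congr (_ + _); rewrite !mxE.
move=> l j; rewrite {}E => /setU1P[->|jJ].
  rewrite Wk /c; case: (eqVneq l k) => [->|lk]; first by rewrite mul0r addr0 Wk.
  by rewrite mulr1 subrr.
by rewrite !WJ // kjF // mulr0 addr0.
Qed.

(** Induction on the number of columns not yet reduced to unit columns. *)
Lemma row_equiv_unitmx (U : 'M[F]_m) : U \in unitmx -> row_equiv U 1%:M.
Proof.
move=> Uu; suff {U Uu} red (J : {set 'I_m}) (U : 'M[F]_m) : U \in unitmx ->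
    (forall i j, j \in J -> U i j = (i == j)%:R) -> row_equiv U 1%:M.
  by apply: (red set0) => // i j; rewrite inE.
move eqn: #|~: J| => d; elim: d J U eqn => [|d IH] J U Jd Uu UJ.
  have -> : U = 1%:M; last exact: rt_refl.
  apply/matrixP => i j; rewrite mxE; apply: UJ.
  by have /setP/(_ j) := cards0_eq Jd; rewrite !inE => /negbFE.
have /set0Pn[k] : ~: J != set0 by rewrite -card_gt0 Jd.
rewrite inE => kJ; have [U' UU' U'J] := row_equiv_pivot Uu kJ UJ.
have U'u : U' \in unitmx.
  rewrite -row_full_unit /row_full; have [<- _] := row_equiv_eqmx UU'.
  by rewrite (mxrank_unit Uu).
apply: rt_trans UU' _; apply: (IH (k |: J)) => //.
have -> : ~: (k |: J) = ~: J :\ k by apply/setP => x; rewrite !inE negb_or.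
by apply/eqP; rewrite -eqSS -Jd (cardsD1 k (~: J)) inE kJ.
Qed.

(** Matrices of equal shape and row space differ by an invertible left factor, which is row
    equivalent to the identity; right multiplication by [B] transports this equivalence. *)
Lemma row_equivP n (A B : 'M[F]_(m, n)) : row_equiv A B <-> (A :=: B)%MS.
Proof.
split=> [|/eqmxP/eqmxMunitP[U Uu ->]]; first exact: row_equiv_eqmx.
by rewrite -{2}[B]mul1mx; apply/row_equiv_mulmxr/row_equiv_unitmx.
Qed.

End RowEquiv.

(** * Monotonicity of deletion-depth under restriction *)

Section DeletionDepth.
Variable E : finType.
Implicit Types (M N : matroid E) (X Y C : {set E}).

(** Function extensionality and proof irrelevance give a Leibniz equality, so that iterated
    restrictions can be rewritten under [dd]. *)
Lemma eq_matroid M N : ground M = ground N -> indep M =1 indep N -> M = N.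
Proof.
case: M N => g i p1 p2 p3 p4 [g' i' q1 q2 q3 q4] /= eg /funext ei.
case: g' / eg q1 => q1; case: i' / ei q1 q2 q3 q4 => q1 q2 q3 q4.
by congr Matroid; apply: Prop_irrelevance.
Qed.

Lemma ground_restrict M X : X \subset ground M -> ground (restrict M X) = X.
Proof. by move=> /setIidPr. Qed.

Lemma restrict_restrict M X Y :
  Y \subset X -> restrict (restrict M X) Y = restrict M Y.
Proof.
move=> YX; apply: eq_matroid => [|I] /=; first by rewrite -setIA (setIidPr YX).
rewrite /restrict_indep /= /restrict_indep; case: (boolP (I \subset Y)) => IY.
  by rewrite (subset_trans IY YX) !andbT.
by rewrite !andbF.
Qed.

Lemma restrict_ground M : restrict M (ground M) = M.
Proof.
apply: eq_matroid => [|I] /=; first exact: setIid.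
by rewrite /restrict_indep; apply: andb_idr; apply: indep_ground.
Qed.

Lemma delete_restrict M X e : X \subset ground M ->
  delete (restrict M X) e = restrict M (X :\ e).
Proof.
by move=> XM; rewrite /delete ground_restrict // restrict_restrict ?subsetDl.
Qed.

Lemma circuitP M C : reflect
  [/\ C \subset ground M, ~~ indep M C & forall D : {set E}, D \proper C -> indep M D]
  (circuit M C).
Proof.
apply: (iffP minsetP) => [[/andP[CM dC] minC]|[CM dC iC]].
  split=> // D DC; apply: contraTT DC => dD.
  rewrite properE; apply/negP => /andP[DC /negP[]].
  by rewrite (minC D) // dD (subset_trans DC).
split=> [|D /andP[_ dD] DC]; first by rewrite CM.
by apply/eqP; apply: contraNT dD => DC'; apply: iC; rewrite properEneq DC'.
Qed.

Lemma circuit_restrict M X C : X \subset ground M ->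
  circuit (restrict M X) C = circuit M C && (C \subset X).
Proof.
move=> XM; apply/circuitP/andP; rewrite ?ground_restrict //=.
  case=> CX dC iC; split=> //; apply/circuitP; split.
  - exact: subset_trans XM.
  - by move: dC; rewrite /restrict_indep CX andbT.
  by move=> D /iC/andP[].
case=> /circuitP[_ dC iC] CX; split=> //; rewrite /restrict_indep ?CX ?andbT //.
by move=> D DC; rewrite iC // (subset_trans (proper_sub DC)).
Qed.

Lemma connectedP M : reflect
  {in ground M &, forall x y, x != y ->
    exists C, [/\ circuit M C, x \in C & y \in C]} (connected M).
Proof.
apply: (iffP 'forall_in_forall_inP) => [cM x y xM yM xy|cM x xM y yM].
  by have /implyP/(_ xy)/existsP[C /and3P[]] := cM x xM y yM; exists C.
apply/implyP => xy; have [C [cC xC yC]] := cM x y xM yM xy.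
by apply/existsP; exists C; rewrite cC xC.
Qed.

Lemma component_subset M X :
  component M X -> X \subset ground M /\ connected (restrict M X).
Proof. by move=> /maxsetp/andP. Qed.

Lemma sub_component M X : X \subset ground M -> connected (restrict M X) ->
  exists2 Y : {set E}, X \subset Y & component M Y.
Proof.
move=> XM cX; have [|Y cY XY] := @maxset_exists _ (fun Y : {set E} =>
  (Y \subset ground M) && connected (restrict M Y)) X; first by rewrite XM.
by exists Y.
Qed.

(** This includes the empty ground set, where [dd] takes its default value 1. *)
Lemma dd_card_le1 M : #|ground M| <= 1 -> dd M = 1.
Proof.
rewrite leq_eqVlt => /orP[/eqP/dd1//|]; rewrite ltnS leqn0 => /eqP M0.
by rewrite /dd M0.
Qed.

(** Induction on the sum of the sizes: a component of [X] is again a subset of [Y], and a connected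
    [X] lies in a single component of [Y], which reduces to the case where both are connected. *)
Lemma dd_restrict_mono M X Y :
  X \subset Y -> Y \subset ground M -> dd (restrict M X) <= dd (restrict M Y).
Proof.
move eqn: (#|X| + #|Y|) => n; elim/ltn_ind: n X Y eqn => n IH X Y eqn XY YM.
have XM := subset_trans XY YM.
have gX := ground_restrict XM; have gY := ground_restrict YM.
have [Y1|Y1] := leqP #|Y| 1.
  rewrite !dd_card_le1 ?gX ?gY //; apply: leq_trans Y1; exact: subset_leq_card.
have [cX|ncX] := boolP (connected (restrict M X)); last first.
  rewrite [leqLHS]dd_disconnected //; apply/bigmax_leqP => C cC.
  have := component_proper ncX cC; rewrite gX.
  have [CX _] := component_subset cC; rewrite gX in CX.
  rewrite (restrict_restrict _ CX) (ground_restrict (subset_trans CX XM)) => lt.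
  apply: (IH (#|C| + #|Y|)) => //; last exact: subset_trans XY.
  by rewrite -eqn ltn_add2r.
have [cY|ncY] := boolP (connected (restrict M Y)); last first.
  rewrite [leqRHS]dd_disconnected //.
  have [||C XC cC] := sub_component (M := restrict M Y) (X := X).
  - by rewrite gY.
  - by rewrite restrict_restrict.
  have := component_proper ncY cC; rewrite gY.
  have [CY _] := component_subset cC; rewrite gY in CY.
  rewrite (restrict_restrict _ CY) (ground_restrict (subset_trans CY YM)) => lt.
  apply: leq_trans (leq_bigmax_cond _ cC); rewrite (restrict_restrict _ CY).
  apply: (IH (#|X| + #|C|)) => //; last exact: subset_trans YM.
  by rewrite -eqn ltn_add2l.
rewrite [leqRHS]dd_connected ?gY //.
have Y0 : Y != set0 by rewrite -card_gt0 ltnW.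
(* An optimal element [e] of [Y] is removed from both sets; if [e] is not in [X], then [X] already
   lies in [Y :\ e]. *)
have [e eY [-> _]] := min_overP (fun e => dd (delete (restrict M Y) e)) Y0.
rewrite delete_restrict //.
have YeM : Y :\ e \subset ground M := subset_trans (subsetDl _ _) YM.
have ltY : #|Y :\ e| < #|Y| by rewrite [ltnRHS](cardsD1 e) eY.
have [eX|eX] := boolP (e \in X); last first.
  apply: leqW; apply: (IH (#|X| + #|Y :\ e|)) => //.
    by rewrite -eqn ltn_add2l.
  by rewrite subsetD1 XY.
have [X1|X1] := leqP #|X| 1; first by rewrite dd_card_le1 ?gX.
rewrite [leqLHS]dd_connected ?gX // ltnS.
have X0 : X != set0 by rewrite -card_gt0 ltnW.
have [f fX [-> /(_ e eX)]] := min_overP (fun e => dd (delete (restrict M X) e)) X0.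
move=> /leq_trans; apply; rewrite delete_restrict //.
apply: (IH (#|X :\ e| + #|Y :\ e|)) => //; last exact: setSD.
by rewrite -eqn -addSn leq_add // ?(ltnW ltY) // [ltnRHS](cardsD1 e) eX.
Qed.

(** For a connected set this is the recursion itself. In general only a component through [x] is
    affected; any other lies inside [X :\ x], where monotonicity applies. *)
Lemma dd_restrict_del M X x : X \subset ground M -> x \in X ->
  dd (restrict M X) <= (dd (restrict M (X :\ x))).+1.
Proof.
move=> XM xX.
have conn C : C \subset ground M -> connected (restrict M C) -> x \in C ->
    dd (restrict M C) <= (dd (restrict M (C :\ x))).+1.
  move=> CM cC xC; have gC := ground_restrict CM.
  have [C1|C1] := leqP #|C| 1; first by rewrite dd_card_le1 ?gC.
  rewrite [leqLHS]dd_connected ?gC // ltnS.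
  have C0 : C != set0 by rewrite -card_gt0 ltnW.
  have [f _ [-> /(_ x xC)]] := min_overP (fun e => dd (delete (restrict M C) e)) C0.
  by rewrite (delete_restrict x CM).
have [cX|ncX] := boolP (connected (restrict M X)); first exact: conn.
rewrite [leqLHS]dd_disconnected //; apply/bigmax_leqP => C cC.
have [] := component_subset cC; rewrite ground_restrict // => CX.
rewrite restrict_restrict // => cMC.
have [xC|xC] := boolP (x \in C); last first.
  apply: leqW; apply: dd_restrict_mono; last exact: subset_trans (subsetDl _ _) XM.
  by rewrite subsetD1 CX.
apply: leq_trans (conn C _ cMC xC) _; first exact: subset_trans XM.
rewrite ltnS; apply: dd_restrict_mono; first exact: setSD.
exact: subset_trans (subsetDl _ _) XM.
Qed.

End DeletionDepth.

(** * Coordinate projections and supports of vectors *)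

Section CoordinateProjection.
Local Open Scope ring_scope.
Variables (F : fieldType) (n : nat).
Implicit Types (X Y : {set 'I_n}) (c d : 'cV[F]_n).

(** Columns outside [X] are zeroed rather than removed, so that the row spaces for different [X]
    live in one ambient space. *)
Definition coord_proj X : 'M[F]_n := diag_mx (\row_j (j \in X)%:R).

Lemma mulmx_coordE m (A : 'M[F]_(m, n)) X i j :
  (A *m coord_proj X) i j = if j \in X then A i j else 0.
Proof.
by rewrite mul_mx_diag !mxE; case: (j \in X); rewrite ?mulr1 ?mulr0.
Qed.

Lemma coord_mulmxE p (A : 'M[F]_(n, p)) X i j :
  (coord_proj X *m A) i j = if i \in X then A i j else 0.
Proof.
by rewrite mul_diag_mx !mxE; case: (i \in X); rewrite ?mul1r ?mul0r.
Qed.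

Lemma coord_projM X Y :
  coord_proj X *m coord_proj Y = coord_proj (X :&: Y).
Proof.
apply/matrixP => i j; rewrite mulmx_coordE !mxE inE.
have [->|ij] := eqVneq i j; last by rewrite !mulr0n if_same.
by case: (j \in X); case: (j \in Y).
Qed.

Lemma coord_projD X Y : Y \subset X ->
  coord_proj X = coord_proj Y + coord_proj (X :\: Y).
Proof.
move=> /subsetP YX; apply/matrixP => i j; rewrite !mxE inE -mulrnDl.
have := YX i; case: (i \in Y) => [->//|_]; first by rewrite addr0.
by rewrite add0r.
Qed.

Lemma coord_projT : coord_proj setT = 1%:M.
Proof. by apply/matrixP => i j; rewrite !mxE inE. Qed.

Definition supp c : {set 'I_n} := [set j | c j 0 != 0].

Lemma suppP c j : reflect (c j 0 = 0) (j \notin supp c).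
Proof. by rewrite inE negbK; apply: eqP. Qed.

Lemma supp_eq0 c : (supp c == set0) = (c == 0).
Proof.
apply/eqP/eqP => [c0|->]; last by apply/setP => j; rewrite !inE mxE eqxx.
by apply/colP => j; rewrite mxE; apply/suppP; rewrite c0 inE.
Qed.

Lemma coord_proj_supp c X : supp c \subset X -> coord_proj X *m c = c.
Proof.
move=> /subsetP cX; apply/colP => j; rewrite coord_mulmxE.
by case: ifP => // /negbT jX; rewrite (suppP _ _ (contra (cX j) jX)).
Qed.

Lemma supp_coord_proj c X : supp (coord_proj X *m c) = supp c :&: X.
Proof.
apply/setP => j; rewrite !inE coord_mulmxE andbC.
by case: (j \in X); rewrite ?eqxx.
Qed.

(** Circuit elimination on the level of vectors: coordinate [y] cancels when [y] lies in
    [supp d]. *)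
Definition eliminate c d y := c - (c y 0 / d y 0) *: d.

Lemma mulmx_eliminate m (A : 'M[F]_(m, n)) c d y :
  A *m c = 0 -> A *m d = 0 -> A *m eliminate c d y = 0.
Proof. by move=> Ac Ad; rewrite mulmxBr -scalemxAr Ac Ad scaler0 subr0. Qed.

Lemma supp_eliminate c d y : y \in supp d ->
  supp (eliminate c d y) \subset (supp c :|: supp d) :\ y.
Proof.
rewrite inE => dy; apply/subsetP => j; rewrite !inE !mxE.
apply: contraR; rewrite !negb_and !negb_or !negbK.
case/orP=> [/eqP->|/andP[/eqP-> /eqP->]]; last by rewrite mulr0 subr0.
by rewrite divfK // subrr.
Qed.

Lemma mem_supp_eliminate c d x y :
  x \in supp c -> x \notin supp d -> x \in supp (eliminate c d y).
Proof. by rewrite !inE !mxE => xc; rewrite negbK => /eqP->; rewrite mulr0 subr0. Qed.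

End CoordinateProjection.

(** * Circuits and separations of the column matroid *)

Section ColumnCircuits.
Local Open Scope ring_scope.
Variables (F : fieldType) (m n : nat) (A : 'M[F]_(m, n)).
Implicit Types (X Y C : {set 'I_n}) (c d : 'cV[F]_n).
Local Notation M := (column_matroid A).

Lemma mulmx_supp c X : supp c \subset X ->
  A *m c = \sum_(j <- enum X) c j 0 *: col j A.
Proof.
move=> /subsetP cX; apply/colP => i; rewrite big_enum summxE mxE [RHS]big_mkcond.
apply: eq_bigr => j _; rewrite !mxE mulrC; case: ifP => // /negbT jX.
by rewrite (suppP _ _ (contra (cX j) jX)) mul0r.
Qed.

(** Coefficients along [enum X] are the same as vectors supported in [X], which turns linear
    dependencies into kernel vectors of [A]. *)
Lemma col_indepP X : reflect
  (forall c, supp c \subset X -> A *m c = 0 -> c = 0) (col_indep A X).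
Proof.
pose s := [seq col j A | j <- enum X].
have sum_nth j0 c : supp c \subset X ->
    A *m c = \sum_(i < size s) c (nth j0 (enum X) i) 0 *: s`_i.
  move/mulmx_supp->; rewrite (big_nth j0) big_mkord size_map.
  by apply: eq_bigr => i _; rewrite (nth_map j0).
apply: (iffP (@freeP _ _ _ (in_tuple s))) => [fX c cX Ac|kX k ks i].
  apply/eqP; rewrite -supp_eq0 -subset0; apply/subsetP => j jc.
  have jX := subsetP cX j jc; rewrite (sum_nth j) // in Ac.
  have jlt : (index j (enum X) < size s)%N.
    by rewrite size_map index_mem mem_enum.
  have /(_ (Ordinal jlt))/= := fX (fun i => c (nth j (enum X) i) 0) Ac.
  by rewrite nth_index ?mem_enum // => /eqP; rewrite inE in jc; rewrite (negPf jc).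
have iX : (i < size (enum X))%N by rewrite -(size_map (fun j => col j A)).
have j0 : 'I_n by case: (enum X) iX => // j.
pose c : 'cV[F]_n := \col_j (if j \in X then
  oapp k 0 (insub (index j (enum X)) : option 'I_(size s)) else 0).
have cnth (a : 'I_(size s)) : c (nth j0 (enum X) a) 0 = k a.
  have aX : (a < size (enum X))%N by rewrite -(size_map (fun j => col j A)).
  rewrite mxE -mem_enum mem_nth // index_uniq ?enum_uniq //.
  by rewrite valK.
have cX : supp c \subset X.
  by apply/subsetP => j; rewrite inE mxE; case: ifP => //; rewrite eqxx.
rewrite -cnth (kX c cX) ?mxE // (sum_nth j0) //.
by rewrite -[RHS]ks; apply: eq_bigr => a _; rewrite cnth.
Qed.

(** Dependent sets are those containing the support of a nonzero kernel vector, so circuits are the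
    minimal such supports. *)
Lemma circuit_suppP c : A *m c = 0 -> c != 0 -> reflect
  (forall d, A *m d = 0 -> d != 0 -> supp d \subset supp c -> supp d = supp c)
  (circuit M (supp c)).
Proof.
move=> Ac c0; apply: (iffP (circuitP _ _)) => [[_ _ iC] d Ad d0 dc|minc].
  apply/eqP; rewrite eqEsubset dc; apply: contraR d0 => cd; apply/eqP.
  by apply: (col_indepP _ (iC (supp d) _)) => //; rewrite properE dc.
split=> [||D Dc]; first exact: subsetT.
  by apply/col_indepP => /(_ c (subxx _) Ac)/eqP; apply/negP.
apply/col_indepP => d dD Ad; apply/eqP/negPn/negP => d0.
move: Dc; rewrite properE => /andP[Dc /negP[]].
by rewrite -(minc d) // (subset_trans dD).
Qed.

Lemma circuit_supp C : circuit M C -> exists2 c, A *m c = 0 & supp c = C.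
Proof.
case/circuitP => _ /col_indepP dC iC.
have [[c [Ac cC c0]]|noc] := pselect (exists c,
    [/\ A *m c = 0, supp c \subset C & c != 0]).
  exists c => //; apply/eqP; rewrite eqEsubset cC; apply: contraR c0 => Cc.
  apply/eqP; apply: (col_indepP _ (iC (supp c) _)) => //.
  by rewrite properE cC.
case: dC => c cC Ac; apply/eqP; apply: contra_notT noc => c0.
by exists c.
Qed.

(** If [supp c] is not a circuit, it properly contains the support of a nonzero kernel vector [d].
    Either [d] has [x] in its support, or cancelling some [y] of [supp d] from [c] shrinks the
    support and keeps [x]. *)
Lemma exists_circuit c x : A *m c = 0 -> x \in supp c ->
  exists d, [/\ A *m d = 0, supp d \subset supp c, x \in supp d
              & circuit M (supp d)].
Proof.
move eqk: #|supp c| => k; elim/ltn_ind: k c eqk => k IH c eqk Ac xc.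
have c0 : c != 0 by rewrite -supp_eq0; apply/set0Pn; exists x.
have shrink d : A *m d = 0 -> supp d \proper supp c -> x \in supp d ->
    exists d, [/\ A *m d = 0, supp d \subset supp c, x \in supp d
              & circuit M (supp d)].
  move=> Ad dc xd; have lt := proper_card dc; rewrite eqk in lt.
  have [d' [Ad' d'd xd' Cd']] := IH _ lt d erefl Ad xd.
  by exists d'; split=> //; apply: subset_trans d'd (proper_sub dc).
have [Cc|/(circuit_suppP Ac c0) notC] := boolP (circuit M (supp c)).
  by exists c.
have [d [Ad d0 dc]] : exists d, [/\ A *m d = 0, d != 0 & supp d \proper supp c].
  apply: contra_notP notC => nod d Ad d0 dc; apply/eqP.
  rewrite eqEsubset dc; apply: contra_notT nod => cd.
  by exists d; rewrite properE dc.
have [xd|xd] := boolP (x \in supp d); first exact: (shrink d).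
have /set0Pn[y yd] : supp d != set0 by rewrite supp_eq0.
have yc := subsetP (proper_sub dc) y yd.
apply: (shrink (eliminate c d y)).
- exact: mulmx_eliminate.
- apply: sub_proper_trans (supp_eliminate c yd) _.
  by rewrite (setUidPl (proper_sub dc)) properD1.
exact: mem_supp_eliminate.
Qed.

Lemma circuit_sub_eq C D : circuit M C -> circuit M D -> C \subset D -> C = D.
Proof.
case/circuitP => _ dC _ /circuitP[_ _ iD] CD.
apply/eqP; rewrite eqEsubset CD; apply: contraR dC => DC.
by apply: iD; rewrite properE CD.
Qed.

(** Cancelling [e] between the kernel vectors of the two circuits keeps [x], which lies in only one
    support; [exists_circuit] then finds a circuit through [x]. *)
Lemma strong_circuit_elimination C D e x : circuit M C -> circuit M D ->
    e \in C -> e \in D -> x \in C -> x \notin D ->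
  exists C', [/\ circuit M C', C' \subset (C :|: D) :\ e & x \in C'].
Proof.
move=> /circuit_supp[c Ac <-] /circuit_supp[d Ad <-] ec ed xc xd.
have [c' [_ c's xc' Cc']] := exists_circuit (mulmx_eliminate e Ac Ad)
  (mem_supp_eliminate e xc xd).
by exists (supp c'); split=> //; apply: subset_trans c's (supp_eliminate _ ed).
Qed.

(** Induction on the size of the union. Eliminating a common element [e] in both directions gives
    circuits [C1] through [x] and [D1] through [z]; either [C1] with [D] or [C1] with [D1] is an
    intersecting pair with smaller union. *)
Lemma circuit_trans C D x z : circuit M C -> circuit M D ->
    x \in C -> z \in D -> C :&: D != set0 ->
  exists C', [/\ circuit M C', C' \subset C :|: D, x \in C' & z \in C'].
Proof.
move eqk: #|C :|: D| => k; elim/ltn_ind: k C D eqk => k IH C D eqk cC cD xC zD.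
case/set0Pn => e /setIP[eC eD].
have [zC|zC] := boolP (z \in C); first by exists C; rewrite subsetUl.
have [xD|xD] := boolP (x \in D); first by exists D; rewrite subsetUr.
have via C1 D1 : circuit M C1 -> circuit M D1 -> x \in C1 -> z \in D1 ->
    C1 :|: D1 \proper C :|: D -> C1 :&: D1 != set0 ->
    exists C', [/\ circuit M C', C' \subset C :|: D, x \in C' & z \in C'].
  move=> cC1 cD1 xC1 zD1 lt ne; have := proper_card lt; rewrite eqk => ltk.
  have [C' [cC' sC' xC' zC']] := IH _ ltk C1 D1 erefl cC1 cD1 xC1 zD1 ne.
  by exists C'; split=> //; apply: subset_trans sC' (proper_sub lt).
have [C1 [cC1 C1s xC1]] := strong_circuit_elimination cC cD eC eD xC xD.
have [D1 [cD1 D1s zD1]] := strong_circuit_elimination cD cC eD eC zD zC.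
rewrite setUC in D1s.
have eC1 : e \notin C1 by move: C1s; rewrite subsetD1 => /andP[].
have eD1 : e \notin D1 by move: D1s; rewrite subsetD1 => /andP[].
(* Otherwise [C1] would lie in [C], hence equal [C], which contains [e]. *)
have C1D : C1 :&: D != set0.
  apply: contraNneq eC1 => C1D0; rewrite (circuit_sub_eq cC1 cC) //.
  apply/subsetP => t tC1; have := subsetP C1s t tC1.
  by rewrite !inE => /andP[_ /orP[//|tD]]; have /setP/(_ t) := C1D0; rewrite !inE tC1 tD.
have C1sub : C1 \subset C :|: D := subset_trans C1s (subsetDl _ _).
have D1sub : D1 \subset C :|: D := subset_trans D1s (subsetDl _ _).
have C1Dsub : C1 :|: D \subset C :|: D by rewrite subUset C1sub subsetUr.
have [/(via C1 D cC1 cD xC1 zD)/(_ C1D)//|] := boolP (C1 :|: D \proper C :|: D).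
rewrite properE C1Dsub negbK => CDsub.
(* Now [C1] contains [C :\: D], which [D1] has to meet: otherwise [D1] would be
   a circuit properly contained in [D]. *)
apply: (via C1 D1) => //.
  apply/properP; split; first by rewrite subUset C1sub.
  by exists e; rewrite !inE ?eC // negb_or eC1.
have [t tD1 tD] : exists2 t, t \in D1 & t \notin D.
  apply/subsetPn; apply: contra eD1 => D1D.
  by rewrite (circuit_sub_eq cD1 cD).
apply/set0Pn; exists t; rewrite inE tD1 andbT.
have tC : t \in C.
  by have := subsetP D1sub t tD1; rewrite !inE (negPf tD) orbF.
by have := subsetP CDsub t; rewrite !inE tC (negPf tD) !orbF => /(_ isT).
Qed.

(* Matroid separation, phrased as the row space of [A] restricted to [X]
   containing its projection to [Y], i.e. being the direct sum of its
   projections to [Y] and to [X :\: Y]. *)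
Definition col_sep X Y : Prop :=
  (A *m coord_proj F Y <= A *m coord_proj F X)%MS.

(** Under separation, the kernel vector of a circuit projects to a kernel vector supported inside
    that circuit, so by minimality the projection is zero or has the full support. *)
Lemma col_sepP X Y : Y \subset X -> col_sep X Y <->
  (forall C, circuit M C -> C \subset X -> (C \subset Y) || [disjoint C & Y]).
Proof.
move=> YX; split=> [/submxP[T eqT] C cC CX|circ].
  have [d Ad eqC] := circuit_supp cC; subst C.
  have d0 : d != 0.
    apply: contraTneq cC => d0; apply/negP => /circuitP[_ /negP[]].
    by move/eqP: d0; rewrite -supp_eq0 => /eqP->; apply: col_indep0.
  have AY : A *m (coord_proj F Y *m d) = 0.
    by rewrite mulmxA eqT -!mulmxA (coord_proj_supp CX) Ad mulmx0.
  have sY := supp_coord_proj d Y.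
  have [/eqP|Yd0] := eqVneq (coord_proj F Y *m d) 0.
    by rewrite -supp_eq0 sY setI_eq0 => ->; rewrite orbT.
  have := circuit_suppP Ad d0 cC _ AY Yd0; rewrite sY subsetIl => /(_ isT)/setIidPl.
  by move=> ->.
(* For the converse, subtracting circuit vectors one at a time shows that every dependency inside
   [X] projects to a dependency inside [Y]. *)
have ker c : supp c \subset X -> A *m c = 0 -> A *m (coord_proj F Y *m c) = 0.
  move eqk: #|supp c| => k; elim/ltn_ind: k c eqk => k IH c eqk cX Ac.
  have [->|c0] := eqVneq c 0; first by rewrite !mulmx0.
  have /set0Pn[x xc] : supp c != set0 by rewrite supp_eq0.
  have [d [Ad dc xd Cd]] := exists_circuit Ac xc.
  have dX := subset_trans dc cX.
  have AYd : A *m (coord_proj F Y *m d) = 0.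
    case/orP: (circ _ Cd dX) => [dY|]; first by rewrite coord_proj_supp.
    rewrite -setI_eq0 -supp_coord_proj supp_eq0 => /eqP->.
    by rewrite mulmx0.
  have sub : supp (eliminate c d x) \subset supp c :\ x.
    by have := supp_eliminate c xd; rewrite (setUidPl dc).
  have lt : (#|supp (eliminate c d x)| < k)%N.
    rewrite -eqk; apply/proper_card/(sub_proper_trans sub).
    by rewrite properD1.
  have := IH _ lt _ erefl (subset_trans sub (subset_trans (subsetDl _ _) cX))
    (mulmx_eliminate x Ac Ad).
  by rewrite mulmxBr -scalemxAr mulmxBr -scalemxAr AYd scaler0 subr0.
(* Row space inclusion is tested on the cokernel [K] of [A *m coord_proj F X]: the columns of
   [coord_proj F X *m K] are dependencies supported in [X], to which [ker] applies. *)
rewrite /col_sep submxE; apply/eqP/matrixP => i k.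
set K := cokermx _; have := ker (coord_proj F X *m (K *m delta_mx k 0)).
have AXK : A *m coord_proj F X *m K = 0 by apply: mulmx_coker.
rewrite supp_coord_proj subsetIr (mulmxA A (coord_proj F X)) (mulmxA _ K) AXK mul0mx.
rewrite (mulmxA (coord_proj F Y)) coord_projM (setIidPl YX) mulmxA (mulmxA _ K).
rewrite -colE => /(_ isT erefl).
by move/colP/(_ i); rewrite !mxE.
Qed.

(** By [circuit_trans], sharing a circuit inside [X] is transitive, so no circuit crosses the
    boundary of the class [Y] of [x]; an element [y] sharing no circuit with [x] makes [Y]
    proper. *)
Lemma disconnected_col_sep X : ~~ connected (restrict M X) ->
  exists Y, [/\ Y \subset X, Y != set0, Y != X & col_sep X Y].
Proof.
have gX : ground (restrict M X) = X by apply/ground_restrict/subsetT.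
move=> /connectedP ncX.
have [x [y [xX yX xy noC]]] : exists x y, [/\ x \in X, y \in X, x != y &
    forall C, circuit M C -> C \subset X -> x \in C -> y \notin C].
  apply: contra_notP ncX => noxy x y; rewrite !gX => xX yX xy.
  apply: contra_notP noxy => noC; exists x, y; split=> // C cC CX xC.
  apply: contra_notN noC => yC; exists C; split=> //.
  by rewrite circuit_restrict ?subsetT // cC.
pose Y := [set z in X | (z == x) ||
  [exists C : {set 'I_n}, [&& circuit M C, C \subset X, x \in C & z \in C]]].
have YX : Y \subset X by apply/subsetP => z; rewrite inE => /andP[].
exists Y; split=> //.
- by apply/set0Pn; exists x; rewrite inE xX eqxx.
- apply: contraTneq (yX) => <-; rewrite inE eq_sym (negPf xy) yX /=.
  apply/existsP => -[C /and4P[cC CX xC]].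
  by apply/negP/noC.
apply/col_sepP => // C cC CX; case: (boolP [disjoint C & Y]) => [|]; first by rewrite orbT.
rewrite -setI_eq0 => /set0Pn[u /setIP[uC]]; rewrite inE orbF => /andP[uX ux].
apply/subsetP => z zC; rewrite inE (subsetP CX) //=; apply/orP; right.
case/orP: ux => [/eqP ux|/existsP[D /and4P[cD DX xD uD]]].
  by apply/existsP; exists C; rewrite cC CX zC -ux uC.
have [|C' [cC' C's xC' zC']] := circuit_trans cD cC xD zC.
  by apply/set0Pn; exists u; rewrite inE uD.
apply/existsP; exists C'; rewrite cC' xC' zC' (subset_trans C's) //.
by rewrite subUset DX.
Qed.

(** Two elements of [C] on different sides would lie in a common circuit, which the separation
    excludes. *)
Lemma connected_col_sep X Y C : Y \subset X -> col_sep X Y -> C \subset X ->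
  connected (restrict M C) -> (C \subset Y) || (C \subset X :\: Y).
Proof.
move=> YX /(col_sepP YX) sXY CX /connectedP cC.
have gC : ground (restrict M C) = C by apply/ground_restrict/subsetT.
rewrite gC in cC.
have [//|/subsetPn[x xC xY]] := boolP (C \subset Y).
apply/subsetP => y yC; rewrite inE (subsetP CX) // andbT.
have [<-//|xy] := eqVneq x y.
have [D []] := cC x y xC yC xy; rewrite circuit_restrict ?subsetT // => /andP[cD DC].
move=> xD yD; case/orP: (sXY D cD (subset_trans DC CX)) => [/subsetP/(_ x xD)|].
  by rewrite (negPf xY).
by move/disjointFr=> ->.
Qed.

(** The recursion of [dd] is read as a derivation; a disconnected set is split in two rather than
    into all its components, and monotonicity bounds both parts. *)
Lemma depth_le_dd X : depth_le col_sep (dd (restrict M X)) X.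
Proof.
have XT (Z : {set _}) : Z \subset ground M by apply: subsetT.
move eqk: #|X| => k; elim/ltn_ind: k X eqk => k IH X eqk.
have gX := ground_restrict (XT X).
have [X1|X1] := leqP #|X| 1.
  rewrite dd_card_le1 ?gX //; apply: depth_leW X1 _; exact: depth_le_card.
have [cX|ncX] := boolP (connected (restrict M X)).
  rewrite dd_connected ?gX //.
  have X0 : X != set0 by rewrite -card_gt0 ltnW.
  have [x xX [-> _]] := min_overP (fun e => dd (delete (restrict M X) e)) X0.
  rewrite delete_restrict //; apply: (depth_le_del xX).
  by apply: IH erefl; rewrite -eqk [ltnRHS](cardsD1 x) xX.
have [Y [YX Y0 neqYX sXY]] := disconnected_col_sep ncX.
apply: (depth_le_sep YX sXY).
  apply: depth_leW (IH _ _ Y erefl); first exact: dd_restrict_mono.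
  by rewrite -eqk proper_card // properEneq neqYX.
apply: depth_leW (IH _ _ (X :\: Y) erefl).
  by apply: dd_restrict_mono; rewrite ?subsetDl.
rewrite -eqk proper_card //; apply/properP; split; first exact: subsetDl.
by have /set0Pn[y yY] := Y0; exists y; rewrite ?inE ?yY // (subsetP YX).
Qed.

(** The empty set is excluded because it has depth 0 while [dd] gives it 1. At a separation, each
    connected subset lies in one part, where monotonicity gives the bound. *)
Lemma dd_le_depth k X : X != set0 -> depth_le col_sep k X ->
  (dd (restrict M X) <= k)%N.
Proof.
have XT (Z : {set _}) : Z \subset ground M by apply: subsetT.
move=> + dX; elim: dX => {k X} [k|k X Y YX sXY _ IHY _ IHZ X0|k X x xX _ IH X0].
- by rewrite eqxx.
- have [Y0|Y0] := eqVneq Y set0; first by move: IHZ; rewrite Y0 setD0; apply.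
  have [Z0|Z0] := eqVneq (X :\: Y) set0.
    have -> : X = Y; last exact: IHY.
    by apply/eqP; rewrite eqEsubset YX -setD_eq0 Z0 eqxx.
  have conn C : C \subset X -> connected (restrict M C) -> (dd (restrict M C) <= k)%N.
    move=> CX cC; case/orP: (connected_col_sep YX sXY CX cC) => CY.
      exact: leq_trans (dd_restrict_mono CY (XT _)) (IHY Y0).
    exact: leq_trans (dd_restrict_mono CY (XT _)) (IHZ Z0).
  have [cX|ncX] := boolP (connected (restrict M X)); first exact: conn.
  rewrite [leqLHS]dd_disconnected //; apply/bigmax_leqP => C cC.
  have [] := component_subset cC; rewrite (ground_restrict (XT X)) => CX.
  by rewrite restrict_restrict //; apply: conn.
have [Xx0|Xx0] := eqVneq (X :\ x) set0.
  rewrite dd_card_le1 // (ground_restrict (XT X)) (cardsD1 x) Xx0 cards0 addn0.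
  by case: (x \in X).
by apply: leq_trans (dd_restrict_del (XT X) xX) _; rewrite ltnS IH.
Qed.

End ColumnCircuits.

(** * From primal graphs to matroid separations and back *)

Section PrimalGraph.
Local Open Scope ring_scope.
Variables (F : fieldType) (n : nat).
Implicit Types (X Y : {set 'I_n}).

Lemma primal_graph_sym m (B : 'M[F]_(m, n)) : symmetric (primal_graph B).
Proof.
move=> i j; rewrite /primal_graph eq_sym; congr (_ && _).
by apply: eq_existsb => r; rewrite andbC.
Qed.

Lemma primal_graph_col_mx m1 m2 (B1 : 'M[F]_(m1, n)) (B2 : 'M[F]_(m2, n)) i j :
  primal_graph (col_mx B1 B2) i j = primal_graph B1 i j || primal_graph B2 i j.
Proof.
rewrite /primal_graph -andb_orr; congr (_ && _).
apply/existsP/orP => [[r]|[]/existsP[r rij]].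
- rewrite -(splitK r) /unsplit; case: (split r) => k.
    by rewrite !col_mxEu => ?; left; apply/existsP; exists k.
  by rewrite !col_mxEd => ?; right; apply/existsP; exists k.
- by exists (lshift _ r); rewrite !col_mxEu.
by exists (rshift _ r); rewrite !col_mxEd.
Qed.

(** Rows in the row space of [A *m coord_proj F X] vanish outside [X], so vertices there are
    isolated. *)
Lemma primal_graph_notin m r (A : 'M[F]_(m, n)) (B : 'M[F]_(r, n)) X i j :
  (B <= A *m coord_proj F X)%MS -> i \notin X -> primal_graph B i j = false.
Proof.
case/submxP=> T -> iX; apply/negP => /andP[_ /existsP[l /andP[/negP[]]]].
by rewrite mulmxA mulmx_coordE (negPf iX).
Qed.

(** A row with a nonzero entry in [Y] has none in [X :\: Y], so its projections to [X] and [Y]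
    coincide; every other row projects to zero on [Y]. *)
Lemma edge_sep_col_sep m (A : 'M[F]_(m, n)) X Y :
  Y \subset X -> edge_sep (primal_graph A) X Y -> col_sep A X Y.
Proof.
move=> YX sXY; apply/row_subP => i.
have [/existsP[y /andP[yY Aiy]]|no] := boolP [exists y, (y \in Y) && (A i y != 0)].
  have -> : row i (A *m coord_proj F Y) = row i (A *m coord_proj F X).
    apply/rowP => z; rewrite mxE mulmx_coordE mxE mulmx_coordE.
    case: (boolP (z \in Y)) => zY; first by rewrite (subsetP YX).
    case: ifP => // zX; apply/esym/eqP/negPn/negP => Aiz.
    have zXY : z \in X :\: Y by rewrite inE zY.
    case/negP: (sXY y z yY zXY); apply/andP; split.
      by apply: contraNneq zY => <-.
    by apply/existsP; exists i; rewrite Aiy.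
  exact: row_sub.
have -> : row i (A *m coord_proj F Y) = 0; last exact: sub0mx.
apply/rowP => z; rewrite mxE mulmx_coordE mxE; case: ifP => // zY.
apply/eqP; apply: contraNT no => Aiz.
by apply/existsP; exists z; rewrite zY.
Qed.

(** The number [r] of rows is left free, since stacking adds rows; the shape is restored by
    [primal_graph_row_basis]. *)
Lemma depth_le_primal_graph m (A : 'M[F]_(m, n)) k X :
    depth_le (col_sep A) k X ->
  exists r (B : 'M[F]_(r, n)), (B == A *m coord_proj F X)%MS /\
    depth_le (edge_sep (primal_graph B)) k X.
Proof.
elim=> {k X} [k|k X Y YX sXY _ [r1 [B1 [eqB1 dY]]] _ [r2 [B2 [eqB2 dZ]]]|k X x xX _].
- exists m, (A *m coord_proj F set0); split; first by rewrite submx_refl.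
  exact: depth_le0.
- have /andP[B1Y YB1] := eqB1; have /andP[B2Z ZB2] := eqB2.
  exists (r1 + r2)%N, (col_mx B1 B2); split.
    apply/andP; split; rewrite -addsmxE.
      rewrite addsmx_sub (submx_trans B1Y sXY) (submx_trans B2Z) //.
      (* By [sXY] the row space contains the projection to [Y], hence also the complementary one, as
         a difference. *)
      have -> : A *m coord_proj F (X :\: Y)
              = A *m coord_proj F X + - (A *m coord_proj F Y).
        by rewrite (coord_projD F YX) mulmxDr addrAC subrr add0r.
      by rewrite addmx_sub // eqmx_opp.
    by rewrite (coord_projD F YX) mulmxDr addmx_sub_adds.
  have inZ y : y \in Y -> y \notin X :\: Y by rewrite inE => ->.
  have inY y : y \in X :\: Y -> y \notin Y by case/setDP.
  apply: (depth_le_sep YX).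
  + move=> y z yY zZ; rewrite primal_graph_col_mx negb_or.
    rewrite primal_graph_sym (primal_graph_notin _ B1Y (inY z zZ)).
    by rewrite (primal_graph_notin _ B2Z (inZ y yY)).
  + apply: sub_depth_le dY => Z Z' ZY Z'Z sZ y z yZ' zZ.
    rewrite primal_graph_col_mx (negPf (sZ y z yZ' zZ)) /=.
    by rewrite (primal_graph_notin _ B2Z) // inZ // (subsetP ZY) // (subsetP Z'Z).
  apply: sub_depth_le dZ => Z Z' ZY Z'Z sZ y z yZ' zZ.
  rewrite primal_graph_col_mx (negPf (sZ y z yZ' zZ)) orbF.
  by rewrite (primal_graph_notin _ B1Y) // inY // (subsetP ZY) // (subsetP Z'Z).
case=> r [B [/andP[/submxP[T eqB] /submxP[S eqS]] dB]].
set AX := A *m coord_proj F X.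
have AXx : AX *m coord_proj F (X :\ x) = A *m coord_proj F (X :\ x).
  by rewrite -mulmxA coord_projM (setIidPr (subsetDl _ _)).
have AXX : AX *m coord_proj F X = AX by rewrite -mulmxA coord_projM setIid.
rewrite -AXx in eqB eqS.
(* [B] is [T *m AX] projected off [x], so [T *m AX] lifts its rows to the row space of [AX]; [K]
   spans the multiples of the unit vector of [x] in that space. *)
pose K := (AX :&: (delta_mx 0 x : 'rV_n))%MS.
exists (r + n)%N, (col_mx (T *m AX) K); split.
  apply/andP; split; rewrite -addsmxE.
    by rewrite addsmx_sub submxMl capmxSl.
  (* The error [D] of the lift vanishes in every column but [x], so its rows belong to [K]. *)
  pose D := AX - S *m (T *m AX).
  have eqAX : AX = S *m (T *m AX) + D by rewrite addrC subrK.
  rewrite [X in (X <= _)%MS]eqAX.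
  have Dx : D *m coord_proj F (X :\ x) = 0.
    by rewrite mulmxBl -(mulmxA S) -(mulmxA T) -eqB -eqS subrr.
  have DX : D *m coord_proj F X = D.
    by rewrite mulmxBl -(mulmxA S) -(mulmxA T) AXX.
  have D_AX : (D <= AX)%MS.
    by rewrite addmx_sub // eqmx_opp mulmx_sub // submxMl.
  apply: addmx_sub_adds; first exact: submxMl.
  rewrite sub_capmx D_AX; apply/submxP; exists (col x D).
  clearbody D; apply/matrixP => i j; rewrite !mxE big_ord1 !mxE eqxx /=.
  have [->|jx] := eqVneq j x; first by rewrite mulr1.
  rewrite mulr0; have [jX|jX] := boolP (j \in X).
    by have /matrixP/(_ i j) := Dx; rewrite mulmx_coordE !inE jx jX mxE.
  by rewrite -DX mulmx_coordE (negPf jX).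
(* On [X :\ x] the lifted rows agree with [B] and the rows of [K] vanish, so no new edge appears. *)
apply: (depth_le_del xX); apply: sub_depth_le dB => Z Z' ZX Z'Z sZ y z yZ' zZ.
have zX : z \in X :\ x by apply: (subsetP ZX); case/setDP: zZ.
have yX : y \in X :\ x by apply/(subsetP ZX)/(subsetP Z'Z).
rewrite primal_graph_col_mx negb_or; apply/andP; split.
  apply: contraNN (sZ y z yZ' zZ) => /andP[yz /existsP[l /andP[ly lz]]].
  apply/andP; split=> //; apply/existsP; exists l.
  by rewrite eqB mulmxA !mulmx_coordE yX zX ly.
apply/negP => /andP[_ /existsP[l /andP[/negP[]]]]; apply/eqP.
have /submxP[D ->] : (K <= (delta_mx 0 x : 'rV_n))%MS by apply: capmxSr.
rewrite mxE big_ord1 !mxE eqxx /=; case/setD1P: yX => /negPf-> _.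
by rewrite mulr0.
Qed.

(** Row operations preserve the number of rows, while the spanning set [B] may have any number: a
    basis chosen among its rows fits into [m] rows, and the padding by zero rows creates no edge. *)
Lemma primal_graph_row_basis m r (A : 'M[F]_(m, n)) (B : 'M[F]_(r, n)) :
    (B == A)%MS ->
  exists2 B' : 'M[F]_(m, n), (A :=: B')%MS &
    subrel (primal_graph B') (primal_graph B).
Proof.
move=> /eqmxP eqAB.
pose row_of (i : 'I_m) : option 'I_(\rank B) := insub (val i).
exists (\matrix_i if row_of i is Some j then row (maxrankfun B j) B else 0).
  apply: eqmx_trans (eqmx_sym eqAB) _; apply/eqmxP/andP; split.
    rewrite -(eq_maxrowsub B); apply/row_subP => j; rewrite row_rowsub.
    have jm : (j < m)%N.
      by apply: leq_trans (ltn_ord j) _; rewrite eqAB rank_leq_row.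
    have -> : row (maxrankfun B j) B = row (Ordinal jm)
       (\matrix_i if row_of i is Some j then row (maxrankfun B j) B else 0).
      by rewrite rowK /row_of valK.
    exact: row_sub.
  apply/row_subP => i; rewrite rowK; case: (row_of i) => [j|].
    exact: row_sub.
  exact: sub0mx.
move=> i j /andP[ij /existsP[l]]; rewrite !mxE.
case: (row_of l) => [t|]; last by rewrite !mxE eqxx.
by rewrite !mxE => h; rewrite /primal_graph ij; apply/existsP; exists (maxrankfun B t).
Qed.

End PrimalGraph.

Theorem theorem4 (F : fieldType) (m n : nat) (A : 'M[F]_(m, n)) (n_gt0 : 0 < n) :
  tdP_star A = dd (column_matroid A).
Proof.
rewrite -(restrict_ground (column_matroid A)) /tdP_star.
case: ex_minnP => k /asboolP[A' /row_equivP AA' <-] kmin.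
apply/eqP; rewrite eqn_leq; apply/andP; split.
  (* The derivation of depth [dd] yields a matrix equivalent to [A] of at most that tree-depth. *)
  have [r [B [eqB dB]]] := depth_le_primal_graph (depth_le_dd A setT).
  rewrite coord_projT mulmx1 in eqB.
  have [B' AB' BB'] := primal_graph_row_basis eqB.
  apply: (@leq_trans (tdP B')).
    by apply: kmin; apply/asboolP; exists B' => //; apply/row_equivP.
  apply/treedepth_le; first exact: primal_graph_sym.
  apply: sub_depth_le dB => X Y _ _ sXY y z yY zX.
  by apply: contra (sXY y z yY zX); apply: BB'.
apply: dd_le_depth.
  by apply/set0Pn; exists (Ordinal n_gt0); rewrite inE.
(* A derivation for the primal graph of the optimal [A'] is one for matroid separations, which
   depend only on the row space shared with [A]. *)
have /treedepth_le-/(_ (primal_graph_sym A')) := leqnn (tdP A').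
apply: sub_depth_le => X Y _ YX /(edge_sep_col_sep YX).
by rewrite /col_sep !(eqmxMr _ AA').
Qed.
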